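(* Let $a=\sum_{n\in\mathbb{Z},\,n\equiv1\pmod 3}x^{n^2}\in\mathbb{Z}/2[[x]]$ and let $B(a)$ be the set of integers $n$ such that the coefficient of $x^n$ in the Laurent series $1/a$ is $1$. Suppose $n\equiv1\pmod 4$ and $n\in B(a)$. Then the number of pairs $(s_1,s_2)$ of perfect squares (squares of integers) with $s_1+4s_2=n$ is odd. Furthermore, $n$ is the product of a prime and a square.
   Context: $1/a$ is computed in the field of Laurent series over $\mathbb{Z}/2$. *)

(* Defs.v *)
From HB Require Import structures.
From mathcomp Require Import all_boot all_order all_algebra.
From mathcomp Require Import all_classical.

Set Implicit Arguments.
Unset Strict Implicit.
Unset Printing Implicit Defensive.
Import Order.TTheory GRing.Theory Num.Theory.

Local Open Scope classical_set_scope.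
Local Open Scope ring_scope.

(* Formal Laurent series over a field K: coefficient families indexed by int
   that vanish below some index. *)
Section LaurentType.
Variable K : fieldType.

Definition vanishes_below (f : int -> K) (s : int) : Prop :=
  forall n, n < s -> f n = 0.

Definition laurent_pred : {pred (int -> K)} :=
  [pred f | `[< exists s, vanishes_below f s >]].

Record laurent :=
  Laurent { coefl :> int -> K; _ : coefl \in laurent_pred }.

HB.instance Definition _ := [isSub for coefl].
HB.instance Definition _ := [Choice of laurent by <:].

Lemma laurent_zmod_closed : zmod_closed laurent_pred.
Proof.
split; first by apply/asboolP; exists 0.
move=> f g /asboolP[s fs] /asboolP[t gt]; apply/asboolP.
exists (Order.min s t) => n; rewrite lt_min => /andP[ns nt].
by rewrite -[LHS]/(f n - g n) fs // gt // subr0.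
Qed.

HB.instance Definition _ :=
  GRing.isZmodClosed.Build _ laurent_pred laurent_zmod_closed.
HB.instance Definition _ := [SubChoice_isSubZmodule of laurent by <:].

End LaurentType.

Notation "{ 'laurent' K }" := (laurent K) (format "{ 'laurent'  K }").

Section LaurentMul.
Variable K : fieldType.
Implicit Types (f g h : int -> K) (F G H : {laurent K}) (s t u n : int).

(* Cauchy product; the sum is finitely supported when both families vanish
   below some index. *)
Definition convl f g : int -> K :=
  fun n => \sum_(i \in [set: int]) f i * g (n - i).

Definition truncl s f N : {poly K} := \poly_(i < N) f (s + i%:Z).

Lemma laurentP F G : F =1 G -> F = G.
Proof. by move=> FG; apply/val_inj/funext. Qed.

Lemma laurent_vanishes F : exists s, vanishes_below F s.
Proof. by case: F => f /= /asboolP. Qed.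

Lemma coefl0 n : (0 : {laurent K}) n = 0. Proof. by []. Qed.

Lemma coeflD F G n : (F + G) n = F n + G n. Proof. by []. Qed.

Lemma ge_shift s n : s <= n -> exists m : nat, n = s + m%:Z.
Proof. by move=> sn; exists `|n - s|%N; rewrite gez0_abs ?subr_ge0 ?subrKC. Qed.

Lemma convl_vanishes f g s t : vanishes_below f s -> vanishes_below g t ->
  vanishes_below (convl f g) (s + t).
Proof.
move=> fs gt n nst; rewrite /convl fsbig1 // => i _.
have [/fs->|si] := ltP i s; first by rewrite mul0r.
by rewrite gt ?mulr0 // ltrBlDl (lt_le_trans nst) // lerD2r.
Qed.

Lemma convl_coef f g s t (m N : nat) :
    vanishes_below f s -> vanishes_below g t -> (m < N)%N ->
  convl f g (s + t + m%:Z) = (truncl s f N * truncl t g N)`_m.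
Proof.
move=> fs gt mN; rewrite /convl coefM.
pose e (i : nat) := s + i%:Z.
have e_inj : injective e by move=> i j /addrI[].
have eE (j : int) : s + t + m%:Z - (s + j) = t + (m%:Z - j).
  by rewrite opprD -[s + t + _]addrA addrACA subrr add0r addrA.
rewrite (fsbigE (map e (iota 0 m.+1))) ?map_inj_uniq ?iota_uniq //.
  rewrite big_map (eq_bigl xpredT) => [|i]; last by rewrite in_setT.
  rewrite -[iota 0 m.+1]/(index_iota 0 m.+1) big_mkord.
  apply: eq_bigr => -[j /= jm] _.
  rewrite !coef_poly (leq_trans jm) // (leq_ltn_trans (leq_subr _ _) mN).
  by rewrite /e eE subzn.
move=> i _ ir; have [/fs->|/ge_shift[k ik]] := ltP i s; first by rewrite mul0r.
have mk : (m < k)%N.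
  by rewrite ltnNge; apply: contra ir => km; rewrite ik (map_f e) ?mem_iota.
by rewrite [X in _ * X]gt ?mulr0 // ik eE gtrDl subr_lt0 ltz_nat.
Qed.

Lemma truncl_convl f g s t (m N : nat) :
    vanishes_below f s -> vanishes_below g t -> (m < N)%N ->
  (truncl (s + t) (convl f g) N)`_m = (truncl s f N * truncl t g N)`_m.
Proof. by move=> fs gt mN; rewrite coef_poly mN (convl_coef fs gt mN). Qed.

Lemma convl_laurent F G : convl F G \in @laurent_pred K.
Proof.
have [[s Fs] [t Gt]] := (laurent_vanishes F, laurent_vanishes G).
by apply/asboolP; exists (s + t); apply: convl_vanishes.
Qed.

Definition mull F G : {laurent K} := Laurent (convl_laurent F G).

Definition monol_fun n : int -> K := fun i => (i == n)%:R.

Lemma monol_laurent n : monol_fun n \in @laurent_pred K.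
Proof. by apply/asboolP; exists n => i; rewrite /monol_fun => /lt_eqF->. Qed.

(* The monomial x^n. *)
Definition monol n : {laurent K} := Laurent (monol_laurent n).

Lemma vanishes_ext f g s : vanishes_below f s -> vanishes_below g s ->
  (forall m : nat, f (s + m%:Z) = g (s + m%:Z)) -> f =1 g.
Proof.
move=> fs gs fg n; have [ns|/ge_shift[m ->]] := ltP n s; last exact: fg.
by rewrite fs // gs.
Qed.

Lemma mullC : commutative mull.
Proof.
move=> F G; have [[s Fs] [t Gt]] := (laurent_vanishes F, laurent_vanishes G).
apply/laurentP/(vanishes_ext (s := s + t)) => [||m]; first exact: convl_vanishes.
  by rewrite addrC; apply: convl_vanishes.
rewrite /= (convl_coef Fs Gt (ltnSn m)) mulrC [s + t]addrC.
by rewrite (convl_coef Gt Fs (ltnSn m)).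
Qed.

Lemma mullA : associative mull.
Proof.
move=> F G H; have [s Fs] := laurent_vanishes F.
have [[t Gt] [u Hu]] := (laurent_vanishes G, laurent_vanishes H).
have [FGst GHtu] := (convl_vanishes Fs Gt, convl_vanishes Gt Hu).
apply/laurentP/(vanishes_ext (s := s + t + u)) => [||m].
- by rewrite -addrA; apply: convl_vanishes.
- exact: convl_vanishes.
rewrite /= (convl_coef FGst Hu (ltnSn m)) -[s + t + u]addrA.
rewrite (convl_coef Fs GHtu (ltnSn m)).
pose p := truncl s F m.+1; pose q := truncl t G m.+1.
pose r := truncl u H m.+1.
transitivity ((p * (q * r))`_m).
  rewrite !coefM; apply: eq_bigr => i _.
  by rewrite (truncl_convl Gt Hu) // ltnS leq_subr.
rewrite mulrA !coefM; apply: eq_bigr => i _.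
by rewrite (truncl_convl Fs Gt (ltn_ord i)).
Qed.

Lemma mul1l : left_id (monol 0) mull.
Proof.
move=> F; apply/laurentP => n /=.
rewrite /convl (fsbigE [:: 0]) //=.
  by rewrite big_cons big_nil in_setT addr0 subr0 /monol_fun eqxx mul1r.
by move=> i _; rewrite inE /monol_fun => /negPf->; rewrite mul0r.
Qed.

Lemma mullDl : left_distributive mull +%R.
Proof.
move=> F G H; have [s1 F1] := laurent_vanishes F.
have [[s2 G2] [t Ht]] := (laurent_vanishes G, laurent_vanishes H).
pose s := Order.min s1 s2.
have Fs : vanishes_below F s.
  by move=> n; rewrite lt_min => /andP[/F1].
have Gs : vanishes_below G s.
  by move=> n; rewrite lt_min => /andP[_ /G2].
have FGs : vanishes_below (F + G) s.
  by move=> n ns; rewrite coeflD Fs // Gs // addr0.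
apply/laurentP/(vanishes_ext (s := s + t)) => [|n nst|m].
- exact: convl_vanishes.
- by rewrite coeflD /= !(convl_vanishes (s := s) (t := t)) ?addr0.
rewrite coeflD /= !(convl_coef (s := s) (t := t) _ _ (ltnSn m)) //.
rewrite -coefD -mulrDl; congr (coefp m (_ * _)).
apply/polyP => i; rewrite coefD !coef_poly.
by case: ifP => _; rewrite ?addr0 ?coeflD.
Qed.

Lemma onel_neq0 : monol 0 != 0.
Proof.
apply/eqP => /(congr1 (fun F : {laurent K} => F 0)) /eqP.
by rewrite coefl0 /= /monol_fun eqxx oner_eq0.
Qed.

HB.instance Definition _ := GRing.Zmodule_isComNzRing.Build {laurent K}
  mullA mullC mul1l mullDl onel_neq0.

Lemma coefl1 n : (1 : {laurent K}) n = (n == 0)%:R. Proof. by []. Qed.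

Lemma coeflM F G n :
  (F * G) n = \sum_(i \in [set: int]) F i * G (n - i).
Proof. by []. Qed.

Lemma coefl_monol n i : monol n i = (i == n)%:R. Proof. by []. Qed.

Lemma laurent_order F : F != 0 ->
  exists2 s, vanishes_below F s & F s != 0.
Proof.
move=> F0; have [t Ft] := laurent_vanishes F.
have exm : exists m : nat, F (t + m%:Z) != 0.
  apply: contrapT => noF; case/eqP: F0; apply/laurentP.
  apply: (vanishes_ext Ft) => [//|m]; rewrite coefl0; apply/eqP.
  by apply: contrapT => /negP Fm; apply: noF; exists m.
have [m Fm minm] := ex_minnP exm; exists (t + m%:Z) => // n.
have [/Ft//|/ge_shift[k ->]] := ltP n t.
rewrite ltrD2l ltz_nat => km; apply/eqP.
by apply: contraLR km => /minm; rewrite leqNgt.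
Qed.

Fixpoint invl_seq (c : nat -> K) (n : nat) : seq K :=
  if n is k.+1 then
    let r := invl_seq c k in
    rcons r ((c 0%N)^-1 * ((k == 0%N)%:R - \sum_(i < k) c (k - i)%N * r`_i))
  else [::].

Lemma size_invl_seq c (n : nat) : size (invl_seq c n) = n.
Proof. by elim: n => //= n IHn; rewrite size_rcons IHn. Qed.

Lemma nth_invl_seq c (n i : nat) : (i < n)%N ->
  (invl_seq c n)`_i = (invl_seq c i.+1)`_i.
Proof.
elim: n => // n IHn; rewrite ltnS leq_eqVlt => /predU1P[->//|lin].
by rewrite [LHS]/= nth_rcons size_invl_seq lin IHn.
Qed.

Lemma mul_invl_seq (c : nat -> K) (n : nat) : c 0%N != 0 ->
  \sum_(i < n.+1) c (n - i)%N * (invl_seq c i.+1)`_i = (n == 0%N)%:R.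
Proof.
move=> c0; rewrite big_ord_recr /= subnn [X in _ + _ * X]nth_rcons.
rewrite size_invl_seq ltnn eqxx mulrA divff // mul1r.
rewrite (eq_bigr (fun i : 'I_n => c (n - i)%N * (invl_seq c n)`_i)) ?subrKC //.
by move=> i _; rewrite [in RHS]nth_invl_seq.
Qed.

Lemma mull_inv_ex F : F != 0 -> exists G, G * F = 1.
Proof.
move=> /laurent_order[s Fs Fs0]; pose c (i : nat) := F (s + i%:Z).
pose g (n : int) : K := if n + s is Posz k then (invl_seq c k.+1)`_k else 0.
have gs : vanishes_below g (- s).
  by move=> n; rewrite -subr_lt0 opprK /g; case: (n + s).
have gL : g \in @laurent_pred K by apply/asboolP; exists (- s).
exists (Laurent gL); apply/laurentP.
apply: (vanishes_ext (s := - s + s)) => [|n|m].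
- exact: convl_vanishes.
- by rewrite addNr coefl1 => /lt_eqF->.
rewrite coefl1 coeflM -/(convl g F _) (convl_coef gs Fs (ltnSn m)) addNr add0r.
rewrite -[RHS]/((m == 0%N)%:R) -(@mul_invl_seq c).
  rewrite coefM; apply: eq_bigr => i _; rewrite mulrC !coef_poly.
  rewrite ltnS leq_subr ltn_ord; congr (_ * _).
  by rewrite /g addrAC addNr add0r.
by rewrite /c addr0.
Qed.

Definition invl F : {laurent K} := xget 0 [set G | G * F = 1].

Lemma mulVl F : F != 0 -> invl F * F = 1.
Proof. by move=> /mull_inv_ex; apply: xgetPex. Qed.

Lemma invl0 : invl 0 = 0.
Proof.
apply: xgetPN => G /= /eqP; rewrite mulr0 eq_sym.
by rewrite (negPf onel_neq0).
Qed.

HB.instance Definition _ :=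
  GRing.ComNzRing_isField.Build {laurent K} mulVl invl0.

End LaurentMul.

(* The series with coefficient of x^m equal to
   \sum_(n = 1 mod 3) [x^m] x^(n^2), a finite sum for each m. *)
Definition a_coef (m : int) : 'F_2 :=
  \sum_(n \in [set n : int | (n = 1 %[mod 3])%Z]) monol 'F_2 (n ^+ 2) m.

Lemma a_laurent : a_coef \in @laurent_pred 'F_2.
Proof.
apply/asboolP; exists 0 => m m0; rewrite /a_coef fsbig1 // => n _.
by rewrite coefl_monol lt_eqF // (lt_le_trans m0) // sqr_ge0.
Qed.

Definition a_series : {laurent 'F_2} := Laurent a_laurent.

Definition Bset (F : {laurent 'F_2}) : set int := [set n | (F^-1) n = 1].

Definition perfect_square (s : int) : Prop := exists k : int, s = k ^+ 2.

(* Main.v *)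
(* Split a = O + E into its parts with odd and even exponents. Squares are 0
   or 1 mod 4, and mod 2 the even part is a(x^4) = a^4. So in 1/a = a^3 / a^4 the
   terms with exponent 1 mod 4 sum to O E^2 / a^4 = O E, whose coefficient at n
   counts, mod 2, the pairs x, y > 0 prime to 3 with x^2 + 4 y^2 = n. If it is
   nonzero then n = 2 mod 3, so every x, y >= 0 with x^2 + 4 y^2 = n is counted
   and n is not a square.
   On the set of triples x^2 + 4 y z = n, the swap of y and z fixes the
   representations x^2 + 4 y^2 = n, while Zagier's involution fixes the triples
   (d, d, z), i.e. the factorizations n = d (d + 4 z). So the number of
   representations has the parity of half the number of divisors of n, and that
   half is odd only when exactly one prime has odd exponent in n. *)
Require Import Defs.
From mathcomp Require Import all_boot all_order all_algebra.
From mathcomp Require Import all_classical.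
From mathcomp Require Import finmap zify ring.

Set Implicit Arguments.
Unset Strict Implicit.
Unset Printing Implicit Defensive.
Import Order.TTheory GRing.Theory Num.Theory.

(** * Parity of a finite set carrying an involution *)

Lemma odd_size_involution (T : eqType) (f : T -> T) (s : seq T) :
    uniq s -> {in s, forall x, f x \in s} -> {in s, involutive f} ->
  odd (size s) = odd (count (fun x => f x == x) s).
Proof.
have [n] := ubnP (size s); elim: n s => // n IHn s sn s_uniq fs fK.
have [/allP fix_s|/allPn[x xs fx]] := boolP (all (fun x => f x == x) s).
  by rewrite (eq_in_count (a2 := predT)) ?count_predT // => x /fix_s.
(* A moved point [x] and its partner [f x] are removed together: the size drops by 2 and no fixed
   point is lost. *)
have fxs : f x \in rem x s by rewrite mem_rem_uniq // !inE fx fs.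
have remE y : (y \in rem (f x) (rem x s)) = [&& y != f x, y != x & y \in s].
  by rewrite mem_rem_uniq ?rem_uniq // inE mem_rem_uniq // inE.
have s_perm : perm_eq s (x :: f x :: rem (f x) (rem x s)).
  by rewrite (permPl (perm_to_rem xs)) perm_cons perm_to_rem.
rewrite (perm_size s_perm) (permP s_perm) /= fK // (negPf fx) eq_sym (negPf fx).
rewrite negbK !add0n IHn ?rem_uniq //.
- by rewrite (perm_size s_perm) /= in sn; lia.
- move=> y; rewrite !remE => /and3P[yfx yx ys].
  by rewrite fs // (can_in_eq fK) // yx -{1}(fK x xs) (can_in_eq fK) ?fs // yfx.
- by move=> y; rewrite remE => /and3P[_ _ /fK].
Qed.

(** * Representations x^2 + 4 y^2 = n and Zagier's triples *)

Definition reps (n : nat) : seq (nat * nat) :=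
  [seq u <- [seq (x, y) | x <- iota 0 n.+1, y <- iota 0 n.+1]
  | u.1 ^ 2 + 4 * u.2 ^ 2 == n].

Lemma mem_reps n x y : ((x, y) \in reps n) = (x ^ 2 + 4 * y ^ 2 == n).
Proof.
rewrite mem_filter; case: eqP => [xyn|//]; rewrite andTb; rewrite /= in xyn.
by apply/allpairsP; exists (x, y); rewrite !mem_iota; split=> //=; nia.
Qed.

Lemma reps_uniq n : uniq (reps n).
Proof. by rewrite filter_uniq // allpairs_uniq ?iota_uniq // => -[? ?] []. Qed.

(** The box [0, n]^3 loses no solution when n is not a square, since then y and z are positive. For
    n = k^2 all triples (k, 0, z) would be solutions. *)
Definition zagier_triples (n : nat) : seq (nat * nat * nat) :=
  [seq u <- [seq (v, z) | v <- [seq (x, y) | x <- iota 0 n.+1,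
                                             y <- iota 0 n.+1],
                          z <- iota 0 n.+1]
  | u.1.1 ^ 2 + 4 * u.1.2 * u.2 == n].

Section Zagier.
Variable n : nat.
Hypothesis n_nonsquare : forall k, n != k ^ 2.
Hypothesis n1 : n %% 4 = 1.

Lemma mem_zagier x y z :
  ((x, y, z) \in zagier_triples n) = (x ^ 2 + 4 * y * z == n).
Proof.
rewrite mem_filter; case: eqP => [xyz|//]; rewrite andTb; rewrite /= in xyz.
apply/allpairsP.
have y0 : 0 < y.
  by case: y xyz => // xyz; have /eqP[] := n_nonsquare x; lia.
have z0 : 0 < z.
  by case: z xyz => // xyz; have /eqP[] := n_nonsquare x; lia.
have [xn yn zn] : [/\ x < n.+1, y < n.+1 & z < n.+1] by split; nia.
exists ((x, y), z); split=> //; last by rewrite mem_iota.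
by apply/allpairsP; exists (x, y); rewrite !mem_iota.
Qed.

Lemma zagier_uniq : uniq (zagier_triples n).
Proof.
rewrite filter_uniq // allpairs_uniq ?iota_uniq //; last by move=> [? ?] [? ?].
by rewrite allpairs_uniq ?iota_uniq // => -[? ?] [? ?].
Qed.

Definition zagier_swap (u : nat * nat * nat) := (u.1.1, u.2, u.1.2).

(** The involution of Zagier's one-sentence proof of the two-square theorem. Each truncated
    subtraction is exact in the branch where it occurs. *)
Definition zagier (u : nat * nat * nat) :=
  let: (x, y, z) := u in
  if x + z < y then (x + 2 * z, z, y - x - z)
  else if x < 2 * y then (2 * y - x, y, x + z - y)
  else (x - 2 * y, x + z - y, y).

(** If x = 0 or x = 2y then 4 divides n; if y = 0 or z = 0 then n = x^2; if x + z = y then n = (y +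
    z)^2. *)
Lemma zagier_pos x y z : x ^ 2 + 4 * y * z = n ->
  [/\ 0 < x, 0 < y, 0 < z, x != 2 * y & x + z != y].
Proof.
move=> xyz.
have /eqP h2 := n_nonsquare x; have /eqP h1 := n_nonsquare (y + z).
split.
- case: x xyz {h2} => // h; lia.
- case: y xyz {h1} => // h; lia.
- case: z xyz {h1} => // h; lia.
- by apply/eqP => h; nia.
- by apply/eqP => h; nia.
Qed.

Lemma zagier_stable :
  {in zagier_triples n, forall u, zagier u \in zagier_triples n}.
Proof.
move=> [[x y] z]; rewrite mem_zagier => /eqP xyz.
have [x0 y0 z0 /eqP x2y /eqP xzy] := zagier_pos xyz.
rewrite /zagier; case: ifP => h1; last case: ifP => h2;
  rewrite mem_zagier; apply/eqP.
- have [w yE] : exists w, y = x + z + w by exists (y - x - z); lia.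
  by rewrite -xyz yE -addnA addKn addKn; ring.
- have [u yE] : exists u, 2 * y = x + u by exists (2 * y - x); lia.
  have [w xzE] : exists w, x + z = y + w by exists (x + z - y); lia.
  by rewrite -xyz yE xzE !addKn; nia.
- have [u xE] : exists u, x = 2 * y + u by exists (x - 2 * y); lia.
  have -> : x - 2 * y = u by lia.
  have -> : x + z - y = u + z + y by lia.
  by rewrite -xyz xE; ring.
Qed.

(** The first and third branches are exchanged and the middle one is mapped to itself. *)
Lemma zagierK : {in zagier_triples n, involutive zagier}.
Proof.
move=> [[x y] z]; rewrite mem_zagier => /eqP xyz.
have [x0 y0 z0 /eqP x2y /eqP xzy] := zagier_pos xyz.
rewrite /zagier; case: ifP => h1; last case: ifP => h2.
- by rewrite ifF ?ifF; [congr (_, _, _)| |]; lia.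
- by rewrite ifF ?ifT; [congr (_, _, _)| |]; lia.
- by rewrite ifT; [congr (_, _, _)|]; lia.
Qed.

Lemma odd_reps_zagier : odd (size (reps n)) = odd (size (zagier_triples n)).
Proof.
rewrite [RHS](@odd_size_involution _ zagier_swap) ?zagier_uniq //.
- rewrite -size_filter -(size_map (fun u => (u.1, u.2, u.2)) (reps n)).
  congr (odd _); apply/perm_size/uniq_perm.
  + by rewrite map_inj_uniq ?reps_uniq // => -[? ?] [? ?] [-> ->].
  + by rewrite filter_uniq ?zagier_uniq.
  move=> [[x y] z].
  rewrite mem_filter mem_zagier /zagier_swap /= !xpair_eqE eqxx /=.
  apply/mapP/idP => [[[a b]]|/andP[/andP[/eqP<- _] xyz]].
    by rewrite mem_reps => ab [-> -> ->]; rewrite eqxx -mulnA mulnn.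
  by exists (x, z); rewrite // mem_reps -mulnn mulnA.
- by move=> [[x y] z]; rewrite /zagier_swap !mem_zagier mulnAC.
- by move=> [[x y] z].
Qed.

(** * Zagier triples and divisors *)

(** A fixed triple in the first branch would have z = 0, in the third y = 0. The middle branch fixes
    exactly the triples with x = y = d, that is n = d (d + 4z), where d is the smaller of two
    complementary divisors. *)
Lemma odd_zagier_divisors :
  odd (size (zagier_triples n)) = odd (count (fun d => d * d < n) (divisors n)).
Proof.
have n0 : 0 < n by lia.
rewrite (odd_size_involution zagier_uniq zagier_stable zagierK) -!size_filter.
rewrite -(size_map (fun d => (d, d, (n %/ d - d) %/ 4))
                   (seq.filter _ (divisors n))).
congr (odd _); apply/perm_size/uniq_perm.
- by rewrite filter_uniq ?zagier_uniq.
- by rewrite map_inj_uniq ?filter_uniq ?divisors_uniq // => ? ? [].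
move=> [[x y] z]; rewrite mem_filter mem_zagier.
apply/andP/mapP => [[/eqP fix_u /eqP xyz]|[d]].
  have [x0 y0 z0 /eqP x2y /eqP xzy] := zagier_pos xyz.
  have xy : y = x.
    move: fix_u; rewrite /zagier.
    by case: ifP => h1; last case: ifP => h2; case; lia.
  have nx : n = (x + 4 * z) * x by rewrite -xyz xy; nia.
  exists x.
    by rewrite mem_filter -dvdn_divisors // nx dvdn_mull // andbT; nia.
  by rewrite xy nx mulnK // addKn mulKn.
rewrite mem_filter -dvdn_divisors // => /andP[ddn /dvdnP[e ne]] [-> -> ->].
have d0 : 0 < d by case: d ne {ddn} => // ne; lia.
have nd : n %/ d = e by rewrite ne mulnK.
rewrite nd.
(* As d e = 1 mod 4, the residues of d and e agree, so the division of e - d by 4 is exact. *)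
have de : e %% 4 = d %% 4.
  have : (e %% 4) * (d %% 4) %% 4 = 1 by rewrite modnMm -ne.
  have : d %% 4 < 4 by rewrite ltn_pmod.
  have : e %% 4 < 4 by rewrite ltn_pmod.
  by move: (e %% 4) (d %% 4) => [|[|[|[|r]]]] [|[|[|[|s]]]].
have [w ew] : exists w, e = d + 4 * w.
  exists ((e - d) %/ 4); have : d < e by nia. by lia.
have w0 : 0 < w by nia.
rewrite ew addKn mulKn // ne ew; split; last by apply/eqP; nia.
by rewrite /zagier ifF ?ifT; [apply/eqP; congr (_, _, _)| | ]; lia.
Qed.

(** The map d -> n/d exchanges the divisors below and above the square root of n, and none lies on
    it. *)
Lemma size_divisors_nonsquare :
  size (divisors n) = 2 * count (fun d => d * d < n) (divisors n).
Proof.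
have n0 : 0 < n by rewrite lt0n (n_nonsquare 0).
rewrite -(count_predC (fun d => d * d < n)) mul2n -addnn; congr (_ + _).
rewrite -!size_filter -[RHS](size_map (fun d => n %/ d)).
apply/perm_size/uniq_perm.
- by rewrite filter_uniq ?divisors_uniq.
- rewrite map_inj_in_uniq ?filter_uniq ?divisors_uniq // => d1 d2.
  rewrite !mem_filter -!dvdn_divisors //.
  move=> /andP[_ /dvdnP[e1 E1]] /andP[_ /dvdnP[e2 E2]].
  have d10 : 0 < d1 by case: d1 E1 => // ?; lia.
  have d20 : 0 < d2 by case: d2 E2 => // ?; lia.
  by rewrite {1}E1 E2 !mulnK // => e12; nia.
move=> d; rewrite mem_filter -dvdn_divisors //=; apply/andP/mapP.
  move=> [dd /dvdnP[e ne]].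
  have d0 : 0 < d by case: d ne {dd} => // ?; lia.
  have e0 : 0 < e by case: e ne => // ?; lia.
  exists e; last by rewrite {1}ne mulKn.
  rewrite mem_filter -dvdn_divisors // ne dvdn_mulr // andbT.
  by have := n_nonsquare d; nia.
move=> [e]; rewrite mem_filter -dvdn_divisors // => /andP[ee /dvdnP[f nf]] ->.
have e0 : 0 < e by case: e nf {ee} => // ?; lia.
by rewrite nf mulnK // dvdn_mulr //; split=> //; rewrite -leqNgt; nia.
Qed.

End Zagier.

(** * From the divisor count to a prime times a square *)

(** The involution d -> m/d has a fixed point by parity, and a fixed point is a square root of m. *)
Lemma odd_size_divisors_square m :
  0 < m -> odd (size (divisors m)) -> exists k, m = k ^ 2.
Proof.
move=> m0; rewrite (@odd_size_involution _ (fun d => m %/ d)) ?divisors_uniq //.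
- move/odd_gt0; rewrite -has_count => /hasP[d dm /eqP md]; exists d.
  by rewrite -mulnn -{1}md divnK // dvdn_divisors.
- by move=> d; rewrite -!dvdn_divisors // => /dvdn_div.
- move=> d; rewrite -dvdn_divisors // => /dvdnP[q mE].
  have /andP[q0 d0] : (0 < q) && (0 < d) by rewrite -muln_gt0 -mE.
  by rewrite mE mulnK // mulKn.
Qed.

(** Each divisor is p^i d for a unique i <= e and a unique d dividing m; i is recovered as the
    p-adic valuation. *)
Lemma size_divisorsM_prime p e m : prime p -> coprime p m -> 0 < m ->
  size (divisors (p ^ e * m)) = e.+1 * size (divisors m).
Proof.
move=> p_pr pm m0; have p0 := prime_gt0 p_pr.
have log_coprime d : d %| m -> logn p d = 0.
  by move=> dm; rewrite logn_coprime // (coprime_dvdr dm).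
have log_mul i d : d %| m -> logn p (p ^ i * d) = i.
  move=> dm; rewrite lognM ?expn_gt0 ?p0 ?(dvdn_gt0 m0) //.
  by rewrite pfactorK // log_coprime // addn0.
rewrite -{1}(size_iota 0 e.+1).
rewrite -(size_allpairs (fun i d => p ^ i * d)).
apply/perm_size/uniq_perm; first exact: divisors_uniq.
  apply: allpairs_uniq; rewrite ?iota_uniq ?divisors_uniq //.
  move=> [i d] [j d'] /allpairsP[[i1 d1] [_ + [-> ->]]].
  rewrite -dvdn_divisors // => dm /allpairsP[[j1 d2] [_ + [-> ->]]].
  rewrite -dvdn_divisors // => d'm; rewrite /= => eqij.
  have ij : i1 = j1 by rewrite -(log_mul i1 d1) // eqij log_mul.
  by move: eqij => /eqP; rewrite ij eqn_pmul2l ?expn_gt0 ?p0 // => /eqP->.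
move=> x; rewrite -dvdn_divisors ?muln_gt0 ?expn_gt0 ?p0 //.
apply/idP/allpairsP => [xn|[[i d] [+ + ->]]]; last first.
  rewrite mem_iota -dvdn_divisors //= => ie dm.
  by rewrite dvdn_mul // dvdn_exp2l.
have x0 : 0 < x by apply: dvdn_gt0 xn; rewrite muln_gt0 expn_gt0 p0.
have xE : x = p ^ logn p x * x`_p^' by rewrite -p_part partnC.
have copx : coprime p x`_p^' by rewrite prime_coprime // -p'natE // part_pnat.
exists (logn p x, x`_p^'); split=> //.
  rewrite mem_iota add0n ltnS -(log_mul e m) //.
  by rewrite dvdn_leq_log // muln_gt0 expn_gt0 p0.
rewrite -dvdn_divisors // -(@Gauss_dvdr _ (p ^ e)); last first.
  by rewrite coprimeXr // coprime_sym.
by rewrite (dvdn_trans _ xn) // dvdn_part.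
Qed.

Lemma nonsquare_odd_logn n :
  0 < n -> (forall k, n != k ^ 2) -> exists2 p, prime p & odd (logn p n).
Proof.
move=> n0 nsq.
have [/hasP[p]|/hasPn even_log] :=
  boolP (has (fun p => odd (logn p n)) (primes n)).
  by rewrite mem_primes => /and3P[]; exists p.
have /eqP[] := nsq (\prod_(p <- primes n) p ^ (logn p n)./2).
rewrite (big_morph (expn^~ 2) (fun a b => expnMn a b 2) (exp1n 2)).
rewrite [LHS](prod_prime_decomp n0) prime_decompE big_map.
apply: eq_big_seq => p /even_log np /=.
by rewrite -expnM muln2 halfK (negPf np) subn0.
Qed.

Lemma prime_mul_square n : (forall k, n != k ^ 2) ->
    odd (size (divisors n))./2 ->
  exists p k, prime p /\ n = p * k ^ 2.
Proof.
case: (posnP n) => [-> /(_ 0)//|n0] nsq tau.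
have [p p_pr p_odd] := nonsquare_odd_logn n0 nsq.
have p0 := prime_gt0 p_pr.
have nE : n = p ^ logn p n * n`_p^' by rewrite -p_part partnC.
set e := logn p n in p_odd nE; set m := n`_p^' in nE.
have m0 : 0 < m by rewrite part_gt0.
have pm : coprime p m by rewrite prime_coprime // -p'natE // part_pnat.
have [k mk] : exists k, m = k ^ 2.
  (* With e odd, half the number of divisors of n is (e + 1)/2 times that of m, so the latter is
     odd. *)
  apply: odd_size_divisors_square => //.
  move: tau; rewrite nE size_divisorsM_prime //.
  rewrite -(odd_double_half e) p_odd add1n -doubleS -doubleMl doubleK.
  by rewrite oddM => /andP[].
exists p, (p ^ e./2 * k); split=> //.
rewrite nE mk -{1}(odd_double_half e) p_odd expnD expn1.
by rewrite -muln2 expnM expnMn mulnA.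
Qed.

Local Open Scope classical_set_scope.
Local Open Scope ring_scope.

(** * Squaring of series over F_2 *)

Lemma F2_cases (c : 'F_2) : c = 0 \/ c = 1.
Proof. by case: c => -[|[|]] // ?; [left|right]; apply/val_inj. Qed.

Lemma F2_sqr (c : 'F_2) : c * c = c.
Proof. by have [->|->] := F2_cases c; rewrite ?mulr0 ?mulr1. Qed.

Lemma F2_addrr (c : 'F_2) : c + c = 0.
Proof. by have [->|->] := F2_cases c; apply/val_inj. Qed.

Lemma laurent_addrr (F : {laurent 'F_2}) : F + F = 0.
Proof. by apply/laurentP => n; rewrite coeflD F2_addrr. Qed.

(** Frobenius: p(x)^2 = p(x^2), since cross terms cancel in pairs and c^2 = c in F_2. *)
Lemma coef_poly_sqr (p : {poly 'F_2}) m :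
  (p * p)`_m = if odd m then 0 else p`_m./2.
Proof.
elim/poly_ind: p m => [|p c IHp] m; first by rewrite mulr0 !coef0 if_same.
have -> : (p * 'X + c%:P) * (p * 'X + c%:P) = p * p * 'X^2 + (c * c)%:P.
  have pX : p * 'X * c%:P + p * 'X * c%:P = 0.
    by apply/polyP => i; rewrite coefD F2_addrr coef0.
  by rewrite mulrDl !mulrDr addrA -(addrA (_ * _)) [c%:P * _]mulrC pX addr0
             -polyCM expr2; ring.
rewrite !coefD !coefC F2_sqr coefMXn coefMX IHp.
by case: m => [|[|m]] //=; rewrite ?addr0 ?negbK ?subn2.
Qed.

Lemma coefl_sqr (F : {laurent 'F_2}) n :
  (F * F) n = if (2 %| n)%Z then F (n %/ 2)%Z else 0.
Proof.
have [s Fs] := laurent_vanishes F.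
have [ns|/ge_shift[m ->]] := ltP n (s + s).
  rewrite coeflM -/(convl F F n) (convl_vanishes Fs Fs) //.
  by case: ifP => // n2; rewrite Fs //; lia.
rewrite coeflM -/(convl F F _) (convl_coef Fs Fs (ltnSn m)) coef_poly_sqr.
have -> : (2 %| s + s + m%:Z)%Z = ~~ odd m by lia.
case: ifP => //= m2; rewrite coef_poly ifT; last by lia.
by congr (F _); lia.
Qed.

(** * Grading of Laurent series by exponents mod 4 *)

Definition supp4 (r : int) (F : {laurent 'F_2}) : Prop :=
  forall n, F n != 0 -> (n = r %[mod 4])%Z.

Lemma supp4M r s F G : supp4 r F -> supp4 s G -> supp4 (r + s) (F * G).
Proof.
move=> Fr Gs n; apply: contraNP => nrs.
rewrite coeflM fsbig1 // => i _.
have [->|/Fr ir] := eqVneq (F i) 0; first by rewrite mul0r.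
have [->|/Gs nis] := eqVneq (G (n - i)) 0; first by rewrite mulr0.
by case: nrs; lia.
Qed.

Lemma proj4_laurent (r : int) (F : {laurent 'F_2}) :
  (fun n => if (n == r %[mod 4])%Z then F n else 0) \in @laurent_pred 'F_2.
Proof.
have [s Fs] := laurent_vanishes F; apply/asboolP; exists s => n /Fs->.
by rewrite if_same.
Qed.

Definition proj4 r F : {laurent 'F_2} := Laurent (proj4_laurent r F).

Lemma coef_proj4 r F n :
  proj4 r F n = if (n == r %[mod 4])%Z then F n else 0.
Proof. by []. Qed.

Lemma supp4_proj r F : supp4 r (proj4 r F).
Proof.
by move=> n; rewrite coef_proj4; case: ifP => [/eqP|]; rewrite ?eqxx.
Qed.

Lemma proj4D r F G : proj4 r (F + G) = proj4 r F + proj4 r G.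
Proof.
apply/laurentP => n; rewrite coeflD !coef_proj4 coeflD.
by case: ifP; rewrite ?addr0.
Qed.

Lemma proj4_id r F : supp4 r F -> proj4 r F = F.
Proof.
move=> Fr; apply/laurentP => n; rewrite coef_proj4.
case: ifP => // /eqP nr; apply/eqP; rewrite eq_sym.
by apply: contra_notT nr => /Fr.
Qed.

Lemma proj4_eq0 r s F : (r != s %[mod 4])%Z -> supp4 s F -> proj4 r F = 0.
Proof.
move=> rs Fs; apply/laurentP => n; rewrite coef_proj4 coefl0.
case: ifP => // nr; apply/eqP; apply: contraNT rs => /Fs; lia.
Qed.

(** A factor with all exponents divisible by 4 preserves residue classes, so the projection is
    linear over such series. *)
Lemma proj4M r F G : supp4 0 G -> proj4 r (F * G) = proj4 r F * G.
Proof.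
move=> G0; apply/laurentP => n; rewrite coef_proj4 !coeflM.
case: ifP => nr; last first.
  rewrite fsbig1 // => i _; rewrite coef_proj4.
  case: ifP; rewrite ?mul0r // => ir.
  have [->|/G0 ni] := eqVneq (G (n - i)) 0; first by rewrite mulr0.
  by lia.
apply: eq_fsbigr => i _; rewrite coef_proj4; case: ifP => // ir.
have [->|/G0 ni] := eqVneq (G (n - i)) 0; first by rewrite !mulr0.
by lia.
Qed.

(** * The series a, its odd and even parts, and its inverse *)

Lemma eqr_sqr_int (u v : int) : u ^+ 2 = v ^+ 2 -> u = v \/ u = - v.
Proof. by move=> /eqP; rewrite eqf_sqr => /orP[] /eqP; [left|right]. Qed.

(** Exactly one of k and -k is 1 mod 3, so a single index contributes to the coefficient. *)
Lemma a_series_sqr (k : nat) : ~~ (3 %| k)%N -> a_series (k%:Z ^+ 2) = 1.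
Proof.
move=> k3; rewrite /= /a_coef.
pose e : int := if (k %% 3 == 1)%N then k%:Z else - k%:Z.
have e3 : (e = 1 %[mod 3])%Z by rewrite /e; case: ifP; lia.
have ek : k%:Z ^+ 2 = e ^+ 2 by rewrite /e; case: ifP; rewrite ?sqrrN.
rewrite (fsbigE [:: e]) //=.
- by rewrite big_cons big_nil mem_set //= addr0 /monol_fun ek eqxx.
- by move=> i /=; rewrite inE => /eqP->.
move=> i i3; rewrite inE /monol_fun ek => /eqP ie.
case: eqP => // /eqr_sqr_int[ei|ei]; first by case: ie.
by exfalso; lia.
Qed.

Lemma a_series_neq0 m : a_series m != 0 ->
  exists2 k : nat, ~~ (3 %| k)%N & m = k%:Z ^+ 2.
Proof.
move=> am; apply: contrapT => nk; case/eqP: am.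
rewrite /= /a_coef fsbig1 // => i i3; rewrite coefl_monol.
case: eqP => // mi; case: nk; exists `|i|%N; last by rewrite mi; lia.
by move: i3 => /=; lia.
Qed.

Definition a_odd := proj4 1 a_series.
Definition a_even := proj4 0 a_series.

Lemma sqr_int_mod4 (k : nat) :
  (k%:Z ^+ 2 %% 4)%Z = odd k.
Proof.
rewrite -{1}(odd_double_half k) -muln2 PoszD PoszM.
by case: (odd k) => /=; lia.
Qed.

Lemma a_seriesD : a_series = a_odd + a_even.
Proof.
apply/laurentP => n; rewrite coeflD !coef_proj4.
have [->|/a_series_neq0[k _ ->]] := eqVneq (a_series n) 0.
  by rewrite !if_same addr0.
by rewrite sqr_int_mod4; case: (odd k); rewrite ?addr0 ?add0r.
Qed.

(* Modulo 2 the Frobenius gives a(x)^4 = a(x^4), and k |-> 2k matches the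
   exponents k^2 of a with the even exponents of a. *)
Lemma a_even_expr4 : a_even = a_series ^+ 4.
Proof.
apply/laurentP => n; rewrite coef_proj4.
rewrite (exprM _ 2 2) 2!expr2 !coefl_sqr.
have [n4|n4] := eqVneq (n %% 4)%Z (0 %% 4)%Z; last first.
  case: ifP => // n2; case: ifP => // n22; lia.
rewrite ifT; last by lia.
rewrite ifT; last by lia.
have nE : n = 4 * ((n %/ 2)%Z %/ 2)%Z by lia.
move: ((n %/ 2)%Z %/ 2)%Z nE => j ->.
have [aj|/a_series_neq0[k k3 ->]] := eqVneq (a_series j) 0; last first.
  rewrite a_series_sqr // -(@a_series_sqr (2 * k)); last by lia.
  by congr (a_series _); lia.
rewrite aj; apply/eqP; apply: contra_eqT aj => /a_series_neq0[k k3 kj].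
have [h kh] : exists h, k = (2 * h)%N.
  by exists k./2; have := sqr_int_mod4 k; lia.
have -> : j = h%:Z ^+ 2.
  by apply: (@mulfI _ 4) => //; rewrite kj kh PoszM; ring.
by rewrite a_series_sqr ?oner_neq0 //; lia.
Qed.

Lemma a_series_nonzero : a_series != 0.
Proof.
apply/eqP => a0; have := @a_series_sqr 1 isT; rewrite a0 coefl0.
by move/eqP; rewrite eq_sym oner_eq0.
Qed.

(* 1/a = a^3 / a^4, where a^4 only involves exponents divisible by 4. *)
Lemma proj4_a_inv : proj4 1 (a_series^-1) = a_odd * a_even.
Proof.
have a0 := a_series_nonzero.
have a40 : a_series ^+ 4 != 0 by rewrite expf_neq0.
have O1 : supp4 1 a_odd by apply: supp4_proj.
have E0 : supp4 0 a_even by apply: supp4_proj.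
apply: (mulIf a40); rewrite -a_even_expr4 -proj4M //.
have -> : a_series^-1 * a_even =
    a_odd * a_odd * a_odd + a_odd * a_odd * a_even
    + (a_odd * a_even * a_even + a_even * a_even * a_even).
  rewrite [X in _ * X = _]a_even_expr4 exprS mulKf // a_seriesD.
  set O := a_odd; set E := a_even.
  (* The binomial coefficients 3 are split as 1 + 2, and the doubled terms vanish mod 2. *)
  have -> : (O + E) ^+ 3 = O * O * O + O * O * E + (O * E * E + E * E * E)
     + (O * O * E + O * O * E) + (O * E * E + O * E * E) by ring.
  by rewrite !laurent_addrr !addr0.
rewrite !proj4D.
(* The four products have degrees 3, 2, 1, 0 mod 4, so only O E E survives. *)
rewrite (proj4_eq0 (s := 1 + 1 + 1)) //; last by do !apply: supp4M.
rewrite (proj4_eq0 (s := 1 + 1 + 0)) //; last by do !apply: supp4M.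
rewrite (@proj4_id _ (a_odd * _ * _)); last by have := supp4M (supp4M O1 E0) E0.
rewrite (proj4_eq0 (s := 0 + 0 + 0)) //; last by do !apply: supp4M.
by rewrite !add0r addr0.
Qed.

Lemma a_odd_neq0 i : a_odd i != 0 ->
  exists2 x : nat, ~~ (3 %| x)%N & i = x%:Z ^+ 2.
Proof.
by rewrite coef_proj4; case: ifP => _; [exact: a_series_neq0|rewrite eqxx].
Qed.

Lemma a_even_neq0 j : a_even j != 0 ->
  exists2 y : nat, ~~ (3 %| y)%N & j = 4 * y%:Z ^+ 2.
Proof.
rewrite coef_proj4; case: ifP; last by rewrite eqxx.
move=> j4 /a_series_neq0[k k3 jk].
have [h kh] : exists h, k = (2 * h)%N.
  by exists k./2; have := sqr_int_mod4 k; lia.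
by exists h; [lia | rewrite jk kh PoszM; ring].
Qed.

(** * Coefficients of O E as numbers of representations *)

Lemma sqr_nat_mod3 (k : nat) : (k ^ 2 %% 3)%N = ~~ (3 %| k)%N.
Proof.
rewrite -modnXm; have := ltn_pmod k (isT : (0 < 3)%N).
by rewrite /dvdn; case: (k %% 3)%N => [|[|[|]]].
Qed.

Lemma sqr_int_inj_nat : injective (fun k : nat => k%:Z ^+ 2).
Proof. by move=> x y /eqr_sqr_int; lia. Qed.

Lemma F2_natr (k : nat) : k%:R = (odd k)%:R :> 'F_2.
Proof.
by elim: k => // k IHk; rewrite mulrS IHk /=; case: odd; apply/val_inj.
Qed.

(** If x^2 + 4 y^2 = 2 mod 3, both squares are 1 mod 3, so each representation meets the condition
    on a and contributes 1. *)
Lemma coef_a_oddM_even (N : nat) : (N %% 4 = 1)%N -> (N %% 3 = 2)%N ->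
  (a_odd * a_even) N%:Z = (size (reps N))%:R.
Proof.
move=> N1 N2; pose r := [seq u.1%:Z ^+ 2 | u <- reps N].
have r_uniq : uniq r.
  rewrite map_inj_in_uniq ?reps_uniq // => -[x y] [x' y'].
  rewrite !mem_reps => /eqP xyN /eqP xyN' /sqr_int_inj_nat /= xx.
  by rewrite xx in xyN *; congr pair; apply: sqr_int_inj_nat; lia.
rewrite coeflM (fsbigE r) //.
  rewrite (eq_bigl xpredT) => [|i]; last by rewrite in_setT.
  rewrite big_map (eq_big_seq (fun=> 1)).
    by rewrite big_const_seq count_predT iter_addr_0.
  move=> [x y]; rewrite mem_reps => /eqP xyN.
  rewrite -[LHS]/(a_odd (x%:Z ^+ 2) * a_even (N%:Z - x%:Z ^+ 2)).
  have x3 : ~~ (3 %| x)%N.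
    by have := sqr_nat_mod3 x; have := sqr_nat_mod3 y; lia.
  have y3 : ~~ (3 %| 2 * y)%N.
    by have := sqr_nat_mod3 x; have := sqr_nat_mod3 y; lia.
  have -> : N%:Z - x%:Z ^+ 2 = (2 * y)%:Z ^+ 2.
    by rewrite -xyN !PoszD !PoszM -!rmorphXn /=; ring.
  rewrite /a_odd /a_even !coef_proj4 !sqr_int_mod4 !a_series_sqr //.
  have -> : odd x by have := sqr_int_mod4 x; lia.
  by rewrite oddM mulr1.
(* Conversely, a nonzero term comes from some representation (x, y) of N, with i = x^2. *)
move=> i _ ir; have [->|/a_odd_neq0[x x3 ix]] := eqVneq (a_odd i) 0.
  by rewrite mul0r.
have [->|/a_even_neq0[y y3 iy]] := eqVneq (a_even (N%:Z - i)) 0.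
  by rewrite mulr0.
case/negP: ir; apply/mapP; exists (x, y) => //.
by rewrite mem_reps; lia.
Qed.

(** A square has a unique nonnegative root, so pairs of squares correspond to pairs of natural
    numbers. *)
Lemma card_square_pairs (n : nat) :
  ([set s : int * int | [/\ perfect_square s.1, perfect_square s.2
                         & s.1 + 4 * s.2 = n%:Z]] #= `I_(size (reps n)))%card.
Proof.
pose g (u : nat * nat) : int * int := (u.1%:Z ^+ 2, u.2%:Z ^+ 2).
have g_inj : injective g.
  move=> [x y] [x' y'] guv; congr pair; apply: sqr_int_inj_nat.
    exact: (congr1 fst guv).
  exact: (congr1 snd guv).
have -> : [set s : int * int | [/\ perfect_square s.1, perfect_square s.2
                         & s.1 + 4 * s.2 = n%:Z]] =
    [set` [fset g u | u in reps n]%fset].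
  apply/seteqP; split=> [[s1 s2] /= [[x ->] [y ->] xyn]|].
    apply/imfsetP; exists (`|x|%N, `|y|%N); last by congr (_, _) => /=; lia.
    by rewrite /= mem_reps; lia.
  move=> _ /= /imfsetP[[x y] /= xyn ->]; rewrite mem_reps in xyn.
  by rewrite /g /=; split; [exists x|exists y|lia].
apply/card_eq_fsetP; rewrite card_imfset //=.
by rewrite undup_id ?reps_uniq.
Qed.

Theorem theorem2p5 (n : int) (n1 : (n = 1 %[mod 4])%Z) (nB : Bset a_series n) :
  (exists2 k : nat, odd k &
     ([set s : int * int | [/\ perfect_square s.1, perfect_square s.2
                            & s.1 + 4 * s.2 = n]] #= `I_k)%card) /\
  (exists p : nat, exists s : int,
     [/\ prime p, perfect_square s & n = p%:Z * s]).
Proof.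
have cn : (a_odd * a_even) n = 1.
  by rewrite -proj4_a_inv coef_proj4 n1 eqxx; exact: nB.
(* One nonzero term of the product already shows that n = x^2 + 4 y^2 with x, y prime to 3; hence n
   >= 0 and n = 2 mod 3. *)
have [i [Oi Ei]] : exists i, a_odd i != 0 /\ a_even (n - i) != 0.
  apply: contrapT => no; suff : (a_odd * a_even) n = 0.
    by rewrite cn => /eqP; rewrite oner_eq0.
  rewrite coeflM fsbig1 // => i _; apply/eqP; rewrite mulf_eq0.
  by apply: contrapT => /negP; rewrite negb_or => /andP Oi; apply: no; exists i.
have [x x3 ix] := a_odd_neq0 Oi; have [y y3 niy] := a_even_neq0 Ei.
have [N nN] : exists N : nat, n = N%:Z by exists (x ^ 2 + 4 * y ^ 2)%N; lia.
subst n.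
have N1 : (N %% 4 = 1)%N by lia.
have N2 : (N %% 3 = 2)%N.
  by have := sqr_nat_mod3 x; have := sqr_nat_mod3 y; lia.
(* 2 is not a square mod 3. *)
have nsq k : (N != k ^ 2)%N.
  by apply/eqP => Nk; have := sqr_nat_mod3 k; lia.
have odd_reps : odd (size (reps N)).
  move: cn; rewrite coef_a_oddM_even // F2_natr.
  by case: odd => // /eqP; rewrite eq_sym oner_eq0.
split; first by exists (size (reps N)) => //; apply: card_square_pairs.
have [p [k [p_pr Nk]]] : exists p k, prime p /\ N = (p * k ^ 2)%N.
  (* Half the number of divisors of N has the parity of the number of Zagier triples, hence of the
     representations, which is odd. *)
  apply: prime_mul_square => //.
  rewrite size_divisors_nonsquare // mul2n doubleK.
  by rewrite -odd_zagier_divisors // -odd_reps_zagier.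
exists p, (k%:Z ^+ 2); split=> //; first by exists k%:Z.
by rewrite Nk PoszM.
Qed.
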